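(* Let $D$ be a linearly connected digraph all of whose strong components are nontrivial, with the number $\eta$ of strong components satisfying $\eta\ge 3$. Then the limit graph of the sequence $\{C(D^m)\}_{m=1}^\infty$ (which exists) is an expansion of the CS-graph $PT^{(\eta)}_D$ of $D$.
   Context: All digraphs are finite and simple (no loops, no multiple arcs; a pair of opposite arcs is allowed). A strong component is trivial if it has exactly one vertex, and nontrivial otherwise. A digraph $D$ is linearly connected if it is weakly connected and its strong components can be listed as $D_1,\ldots,D_\eta$ so that every arc of $D$ joining two different strong components goes from $D_i$ to $D_{i+1}$ for some $i\in\{1,\ldots,\eta-1\}$; this listing is fixed. For a nontrivial strong component $D_i$, $\kappa_i$ denotes its index of imprimitivity (gcd of the lengths of its directed cycles) and $U^{(i)}_1,\ldots,U^{(i)}_{\kappa_i}$ its sets of imprimitivity: the partition of $V(D_i)$, indexed by $\mathbb{Z}_{\kappa_i}$, such that every arc of $D_i$ goes from $U^{(i)}_j$ to $U^{(i)}_{j+1}$ for some $j$ (indices modulo $\kappa_i$). $D^m$ is the digraph on $V(D)$ with an arc $(u,w)$ iff there is a directed walk of length $m$ from $u$ to $w$ in $D$. $C(D')$ is the simple graph on $V(D')$ in which distinct $u,w$ are adjacent iff some vertex $z$ has both $(u,z)$ and $(w,z)$ as arcs of $D'$. A graph sequence converges if it is eventually constant; the eventual value is its limit. CS-graph. For $1\le p\le\eta-1$ let $I(D_{p,p+1})=\{(k,l)\mid (x,y) \text{ is an arc of } D \text{ for some } x\in U^{(p)}_k,\ y\in U^{(p+1)}_l\}$. The CS-graph $PT^{(\eta)}_D=(V_1,\ldots,V_\eta)$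 is the $\eta$-partite graph with parts $V_p=\mathbb{Z}_{\kappa_p}$ (regarded as pairwise disjoint copies), in which $i\in V_p$ and $j\in V_{p+1}$ are joined by an edge, denoted $(i,j)$, iff there are $(k,l)\in I(D_{p,p+1})$ and an integer $a$ with $i\equiv k+1+a\pmod{\kappa_p}$ and $j\equiv l+a\pmod{\kappa_{p+1}}$; there are no other edges. Paths. In an $\eta$-partite graph $(V_1,\ldots,V_\eta)$ with edges only between consecutive parts, an $(x,z)$-path with $x\in V_p$, $z\in V_q$, $p\le q$, means a path $x=v_p,v_{p+1},\ldots,v_q=z$ with $v_t\in V_t$ for each $t$ and consecutive vertices adjacent. Expansion. Let $G=(V_1,\ldots,V_\eta)$ be an $\eta$-partite graph without edges between $V_i$ and $V_j$ if $|i-j|\ge2$. An expansion of $G$ is any graph obtained as follows. (Step 1) Replace each vertex $v$ with a complete graph $G_v$ (of any size), the $G_v$ being pairwise vertex-disjoint. (Step 2) For distinct vertices $x\in V_i$, $y\in V_j$ with $i\le j$, join every vertex of $G_x$ to every vertex of $G_y$ if there is an integer $k$, $j\le k\le\eta$, such that: when $k\ge j+1$, there are an $(x,z)$-path and a $(y,z)$-path in $G$ for some $z\in V_k$; when $k=j$, there is an $(x,y)$-path in $G$. *)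

(* Defs.v *)
From mathcomp Require Import all_boot all_order all_algebra.
Set Implicit Arguments.
Unset Strict Implicit.
Unset Printing Implicit Defensive.
Import Order.TTheory GRing.Theory Num.Theory.

(* A digraph is a finite type T with an irreflexive arc relation e : rel T.   *)
(* Lists D_1, ..., D_eta and V_1, ..., V_eta are indexed by 'I_eta, from 0.   *)

Definition strong_components (T : finType) (e : rel T) : {set {set T}} :=
  equivalence_partition [rel x y | connect e x y && connect e y x] [set: T].

Definition weakly_connected (T : finType) (e : rel T) : Prop :=
  forall x y : T, connect [rel u v | e u v || e v u] x y.

Definition linear_listing (T : finType) (e : rel T) (eta : nat)
    (D : 'I_eta -> {set T}) : Prop :=
  [/\ injective D,
      [set D p | p : 'I_eta] = strong_components e
    & forall (p q : 'I_eta) (x y : T),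
        p != q -> x \in D p -> y \in D q -> e x y -> q = p.+1 :> nat].

(* D is linearly connected iff linearly_connected e D for some listing D.     *)
Definition linearly_connected (T : finType) (e : rel T) (eta : nat)
    (D : 'I_eta -> {set T}) : Prop :=
  weakly_connected e /\ linear_listing e D.

(* The index of imprimitivity of the subdigraph induced on A: directed cycles *)
(* are repetition-free, so their lengths are at most #|A|.  The empty cycle   *)
(* (n = 0) contributes 0, which is neutral for gcdn.                          *)
Definition kappa (T : finType) (e : rel T) (A : {set T}) : nat :=
  \big[gcdn/0]_(n < #|A|.+1 |
     [exists c : n.-tuple T, ucycleb e c && all (mem A) c]) n.

(* ordS is the successor modulo kappa e A.                                    *)
Definition imprimitivity_sets (T : finType) (e : rel T) (A : {set T})
    (U : 'I_(kappa e A) -> {set T}) : Prop :=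
  [/\ injective U,
      partition [set U j | j : 'I_(kappa e A)] A
    & forall x y : T, x \in A -> y \in A -> e x y ->
        exists j, x \in U j /\ y \in U (ordS j)].

Definition digraph_power (T : finType) (e : rel T) (m : nat) : rel T :=
  [rel u w | [exists c : m.-tuple T, path e u c && (last u c == w)]].

Definition competition_graph (T : finType) (e : rel T) : rel T :=
  [rel u w | (u != w) && [exists z, e u z && e w z]].

Definition graph_limit (T : finType) (G : nat -> rel T) (L : rel T) : Prop :=
  exists M : nat, forall m : nat, M <= m -> G m =2 L.

(* eta-partite graphs whose edges only join consecutive parts.                *)
Record partite_graph (eta : nat) := PartiteGraph {
  vertex : finType;
  part : vertex -> 'I_eta;
  adj : vertex -> vertex -> Prop;
  adj_sym : forall x y, adj x y -> adj y x;
  adj_consecutive : forall x y, adj x y ->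
    part y = (part x).+1 :> nat \/ part x = (part y).+1 :> nat
}.
Arguments part {eta p} _.
Arguments adj {eta p} _ _.

(* v t is the vertex of the path in V_t; only its values for                  *)
(* part x <= t <= part z matter.                                              *)
Definition partite_path (eta : nat) (G : partite_graph eta) (x z : vertex G)
    : Prop :=
  part x <= part z /\
  exists v : nat -> vertex G,
    [/\ v (part x) = x,
        v (part z) = z,
        forall t, part x <= t <= part z -> part (v t) = t :> nat
      & forall t, part x <= t < part z -> adj (v t) (v t.+1)].

(* The condition of Step 2 on x in V_i and y in V_j with i <= j.              *)
Definition step2_joined (eta : nat) (G : partite_graph eta) (x y : vertex G)
    : Prop :=
  part x <= part y /\
  exists k : 'I_eta,
    (part y < k /\
       exists z : vertex G,
         [/\ part z = k, partite_path x z & partite_path y z])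
    \/ (k = part y /\ partite_path x y).

(* B x is the vertex set of the complete graph G_x replacing x.               *)
Definition is_expansion (eta : nat) (G : partite_graph eta)
    (W : finType) (L : rel W) : Prop :=
  exists B : vertex G -> {set W},
    [/\ forall x, B x != set0,
        forall x y, x != y -> [disjoint B x & B y],
        \bigcup_x B x = [set: W]
      & forall u w : W,
          L u w <->
          exists x y : vertex G,
            [/\ u \in B x, w \in B y
              & (x = y /\ u != w)
                \/ (x != y /\ (step2_joined x y \/ step2_joined y x))]].

Section CSGraph.
Context (T : finType) (e : rel T) (eta : nat) (D : 'I_eta -> {set T}).
Context (U : forall p : 'I_eta, 'I_(kappa e (D p)) -> {set T}).

Definition arc_classes (p q : 'I_eta)
    (k : 'I_(kappa e (D p))) (l : 'I_(kappa e (D q))) : Prop :=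
  exists x y : T, [/\ x \in U k, y \in U l & e x y].

Definition cs_vertex : finType := {p : 'I_eta & 'I_(kappa e (D p))}.

(* cs_edge u v: u = i in V_p, v = j in V_(p+1) and (i, j) is an edge.         *)
Definition cs_edge (u v : cs_vertex) : Prop :=
  tag v = (tag u).+1 :> nat /\
  exists (k : 'I_(kappa e (D (tag u)))) (l : 'I_(kappa e (D (tag v)))),
    arc_classes k l /\
    exists a : int,
      ((tagged u)%:Z = (k%:Z + 1 + a)%R %[mod kappa e (D (tag u))])%Z /\
      ((tagged v)%:Z = (l%:Z + a)%R %[mod kappa e (D (tag v))])%Z.

Definition cs_adj (u v : cs_vertex) : Prop := cs_edge u v \/ cs_edge v u.

Lemma cs_adj_sym u v : cs_adj u v -> cs_adj v u.
Proof. by case; [right | left]. Qed.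

Lemma cs_adj_consecutive u v : cs_adj u v ->
  tag v = (tag u).+1 :> nat \/ tag u = (tag v).+1 :> nat.
Proof. by case=> -[-> _]; [left | right]. Qed.

Definition cs_graph : partite_graph eta :=
  @PartiteGraph eta cs_vertex (fun u => tag u) cs_adj
    cs_adj_sym cs_adj_consecutive.

End CSGraph.

(* Main.v *)
(* Fix a start time 0 and attach to a vertex x reached at time m, lying in the
   class c of D_p, the CS-graph vertex c - m of V_p.  A walk keeps this label
   as long as it stays in a strong component, since every arc there advances
   the class by one, and an arc into the next component changes the label along
   an edge of the CS-graph.  So a walk traces a path of the CS-graph.
   Conversely, an edge of the CS-graph only prescribes the time of the crossing
   modulo the period lcm(kappa_p, kappa_{p+1}), and within a strong component
   all long enough walks of the right length modulo kappa exist, so a path of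
   the CS-graph is traced by walks of every large length.  Hence for large m two
   vertices compete in D^m iff paths from their labels have a common endpoint. *)
Require Import Defs.
From mathcomp Require Import all_boot all_order all_algebra.
From mathcomp Require Import ring.

Set Implicit Arguments.
Unset Strict Implicit.
Unset Printing Implicit Defensive.
Import GRing.Theory Num.Theory.

(** * Additive semigroups of natural numbers *)

Definition eventually_multiples (S : nat -> Prop) (g : nat) : Prop :=
  exists N, forall n, N <= n -> g %| n -> S n.

Section AdditiveSemigroup.
Context (S : nat -> Prop) (S0 : S 0) (SD : forall m n, S m -> S n -> S (m + n)).

(** A large multiple of the gcd splits as [s * a] plus a multiple of [g]. Reducing [s] modulo [g]
    keeps [s * a] below [g * a], so the rest still exceeds the old threshold. *)
Lemma eventually_multiples_gcdn (g a : nat) :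
  eventually_multiples S g -> S a -> eventually_multiples S (gcdn g a).
Proof.
move=> [N HN] Sa.
have SM t : S (t * a) by elim: t => [|t IHt] //; rewrite mulSn; apply: SD.
have [->|g_gt0] := posnP g.
  by rewrite gcd0n; exists 0 => n _ /dvdnP[t ->].
have [->|a_gt0] := posnP a; first by rewrite gcdn0; exists N.
exists (N + g * a) => n len /dvdnP[t def_n].
have [km kn def_d _] := egcdnP g a_gt0.
(* Bezout gives [km * a = gcdn a g] modulo [g], hence [n = s * a] modulo [g]. *)
pose s := (t * km) %% g.
have le_sa : s * a <= g * a by rewrite leq_mul2r ltnW ?orbT // ltn_mod.
have le_sn : s * a <= n by apply: leq_trans (leq_trans le_sa (leq_addl N _)) len.
rewrite -(subnK le_sn); apply: SD => //; apply: HN.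
  by rewrite leq_subRL // addnC (leq_trans _ len) // leq_add2l.
rewrite -eqn_mod_dvd // /s modnMml -mulnA def_d mulnDr [gcdn a g]gcdnC -def_n.
by rewrite mulnA modnMDl.
Qed.

Lemma eventually_multiples_dvd (g h : nat) :
  g %| h -> eventually_multiples S g -> eventually_multiples S h.
Proof. by move=> gh [N HN]; exists N => n len /(dvdn_trans gh)/HN; apply. Qed.

(* The step of the induction over the cycles of A: for x outside a cycle of
   length n, only detours of lengths a and a + n are closed walks at x. *)
Lemma eventually_multiples_gcdnB (g a n : nat) :
  eventually_multiples S g -> S a -> S (a + n) ->
  eventually_multiples S (gcdn n g).
Proof.
move=> Gg Sa San.
apply: eventually_multiples_dvd
  (eventually_multiples_gcdn (eventually_multiples_gcdn Gg Sa) San).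
rewrite dvdn_gcd; apply/andP; split; last first.
  exact: dvdn_trans (dvdn_gcdl _ _) (dvdn_gcdl _ _).
rewrite -(dvdn_addr n (dvdn_trans (dvdn_gcdl _ _) (dvdn_gcdr g a))).
exact: dvdn_gcdr.
Qed.

End AdditiveSemigroup.

(** * Walks of prescribed length *)

Section DigraphPower.
Context (T : finType) (e : rel T).
Local Notation walk := (digraph_power e).

Lemma digraph_powerP (m : nat) (x y : T) :
  reflect (exists c, [/\ size c = m, path e x c & last x c = y]) (walk m x y).
Proof.
apply: (iffP existsP) => [[c /andP[pc /eqP lc]]|[c [sc pc lc]]].
  by exists c; rewrite size_tuple.
by exists (tcast sc (in_tuple c)); rewrite val_tcast /= pc lc eqxx.
Qed.

Lemma digraph_power0 (x y : T) : walk 0 x y = (x == y).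
Proof.
apply/digraph_powerP/eqP => [[c [/size0nil-> _]] //|<-].
by exists [::].
Qed.

Lemma digraph_power1 (x y : T) : e x y -> walk 1 x y.
Proof. by move=> exy; apply/digraph_powerP; exists [:: y]; rewrite /= exy. Qed.

Lemma digraph_powerD (m n : nat) (x y z : T) :
  walk m x y -> walk n y z -> walk (m + n) x z.
Proof.
move=> /digraph_powerP[c [<- pc lc]] /digraph_powerP[d [<- pd ld]].
apply/digraph_powerP; exists (c ++ d).
by rewrite size_cat cat_path last_cat lc pc.
Qed.

Lemma digraph_power_rconsP (m : nat) (x z : T) :
  walk m.+1 x z -> exists2 y, walk m x y & e y z.
Proof.
move=> /digraph_powerP[c []]; elim/last_ind: c => // c w _.
rewrite size_rcons rcons_path last_rcons => -[<-] /andP[pc ew] <-.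
by exists (last x c) => //; apply/digraph_powerP; exists c.
Qed.

Lemma connect_digraph_power (x y : T) :
  connect e x y -> exists2 m, m <= #|T| & walk m x y.
Proof.
move=> /connectP[c pc ->]; case/shortenP: pc => d pd ud _.
exists (size d); last by apply/digraph_powerP; exists d.
by rewrite ltnW // -[(size d).+1]/(size (x :: d)) -(card_uniqP ud) max_card.
Qed.

(** The gcd is built one cycle at a time: going from [x] to a vertex [y] of the cycle and back, with
    or without one turn round it, gives the two lengths needed. *)
Lemma eventual_closed_walks (A : {set T}) (x : T) :
  {in A, forall y, connect e x y && connect e y x} ->
  eventually_multiples (fun n => walk n x x) (kappa e A).
Proof.
move=> Ax; rewrite /kappa.
apply: (big_rec (eventually_multiples _)) => [|i g /existsP[c]].
  (* The only multiple of 0 is 0, and threshold 1 excludes it. *)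
  by exists 1 => n n_gt0; rewrite dvd0n; case: n n_gt0.
move=> /andP[/andP[]]; case: c => -[|y c] /= /eqP <- .
  by rewrite gcd0n.
move=> cyc _ /andP[/Ax/andP[/connect_digraph_power[m _ xy]]].
move=> /connect_digraph_power[n _ yx] _ Gg.
have yy : walk (size c).+1 y y.
  apply/digraph_powerP; exists (rcons c y).
  by rewrite size_rcons last_rcons.
apply: (@eventually_multiples_gcdnB _ _ _ g (m + n)) => //.
- by rewrite digraph_power0.
- by move=> a b; apply: digraph_powerD.
- exact: digraph_powerD xy yx.
- by rewrite addnAC -addnA; apply: digraph_powerD xy (digraph_powerD yy yx).
Qed.

End DigraphPower.

Lemma val_iter_ordS (n m : nat) (i : 'I_n) :
  iter m (@ordS n) i = (i + m) %% n :> nat.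
Proof.
elim: m => [|m IHm] /=; first by rewrite addn0 modn_small.
by rewrite IHm -addn1 modnDml addn1 addnS.
Qed.

(** Links the iterated successor of [located] with the integer congruences of [cs_edge]. *)
Lemma iter_ordS_eqz (n m : nat) (i k : 'I_n) :
  iter m (@ordS n) i = k <-> (i%:Z + m%:Z = k%:Z %[mod n])%Z.
Proof.
rewrite -PoszD !modz_nat (modn_small (ltn_ord k)).
split=> [<-|[def_k]]; first by rewrite val_iter_ordS.
by apply: val_inj; rewrite /= val_iter_ordS.
Qed.

Lemma iter_inj (A : Type) (f : A -> A) (m : nat) :
  injective f -> injective (iter m f).
Proof. by move=> f_inj; elim: m => [|m IHm] x y //= /f_inj/IHm. Qed.

(** * Paths in partite graphs *)

Section PartitePaths.
Context (eta : nat) (G : partite_graph eta).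
Implicit Types x y z : vertex G.

Lemma partite_path_refl x : partite_path x x.
Proof.
split=> //; exists (fun=> x); split=> // t; first by rewrite -eqn_leq => /eqP.
by case/andP=> /leq_ltn_trans lt /lt; rewrite ltnn.
Qed.

Lemma partite_path_rcons x y z :
  partite_path x y -> adj y z -> part z = (part y).+1 :> nat ->
  partite_path x z.
Proof.
move=> [le_xy [v [vx vy vP vA]]] yz pz; split; first by rewrite pz ltnW.
exists (fun t => if t <= part y then v t else z); split.
- by rewrite le_xy.
- by rewrite pz ltnn.
- move=> t /andP[xt]; rewrite pz leq_eqVlt => /predU1P[->|]; first by rewrite ltnn.
  by rewrite ltnS => ty; rewrite ty vP // xt.
- move=> t /andP[xt]; rewrite pz ltnS; case: ltngtP => // [ty _|-> _].
    by apply: vA; rewrite xt.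
  by rewrite vy.
Qed.

Lemma partite_path_ind x (P : vertex G -> Prop) :
  P x ->
  (forall y z, P y -> adj y z -> part z = (part y).+1 :> nat -> P z) ->
  forall z, partite_path x z -> P z.
Proof.
move=> Px PS z [le_xz [v [vx vz vP vA]]].
suff Pv n : part x + n <= part z -> P (v (part x + n)).
  by rewrite -vz -(subnKC le_xz); apply: Pv; rewrite subnKC.
elim: n => [|n IHn]; first by rewrite addn0 vx.
rewrite addnS => lt_z; apply: PS (IHn (ltnW lt_z)) _ _.
  by apply: vA; rewrite leq_addr.
by rewrite !vP ?leq_addr ?(ltnW lt_z) // lt_z leqW ?leq_addr.
Qed.

Lemma partite_path_part_eq x z :
  partite_path x z -> part z <= part x -> z = x.
Proof.
(* The inequality is carried through the induction: it makes the second clause vacuous after an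
   appended edge. *)
move=> xz; suff [] : part x <= part z /\ (part z <= part x -> z = x) by [].
move: z xz; apply: partite_path_ind => // y w [le_xy _] _ ->.
by split=> [|lt_yx]; [apply: ltnW | rewrite ltnNge le_xy in lt_yx].
Qed.

(** Both cases of Step 2 ask for a common endpoint: the case [k = part y] takes [y] itself, reached
    from [y] by the trivial path. *)
Lemma step2_joinedP x y :
  (exists z, partite_path x z /\ partite_path y z) <->
  (step2_joined x y \/ step2_joined y x).
Proof.
have half x' y' z : part x' <= part y' -> partite_path x' z ->
    partite_path y' z -> step2_joined x' y'.
  move=> le_xy xz yz; split=> //; exists (part z).
  case: (leqP (part z) (part y')) => [le_zy|lt_yz]; [right | left].
    by rewrite -(partite_path_part_eq yz le_zy).
  by split=> //; exists z.
split=> [[z [xz yz]]|[]].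
- by case: (leqP (part x) (part y)) => [|/ltnW] le; [left | right];
    apply: half le _ _; eassumption.
- move=> [_ [k [[_ [z [_ xz yz]]]|[_ xy]]]]; first by exists z.
  by exists y; split=> //; apply: partite_path_refl.
- move=> [_ [k [[_ [z [_ yz xz]]]|[_ yx]]]]; first by exists z.
  by exists x; split=> //; apply: partite_path_refl.
Qed.

End PartitePaths.

(** * Components, imprimitivity classes and labels *)

Section LinearlyConnected.
Context (T : finType) (e : rel T) (eta : nat) (D : 'I_eta -> {set T}).
Context (U : forall p : 'I_eta, 'I_(kappa e (D p)) -> {set T}).
Context (D_listing : linear_listing e D).
Context (U_imprimitive : forall p : 'I_eta, imprimitivity_sets (@U p)).

Local Notation walk := (digraph_power e).
Local Notation G := (cs_graph U).
Implicit Types (p q : 'I_eta) (v w : vertex G) (x y z : T).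

Lemma mutual_connect_equivalence :
  {in [set: T] & &, equivalence_rel [rel x y | connect e x y && connect e y x]}.
Proof.
move=> x y z _ _ _ /=; split=> [|/andP[xy yx]]; first by rewrite !connect0.
by apply/andP/andP=> -[]; [move=> xz zx | move=> yz zy]; split;
  apply: connect_trans; eassumption.
Qed.

Lemma strong_components_partition : partition (strong_components e) [set: T].
Proof. exact: equivalence_partitionP mutual_connect_equivalence. Qed.

Lemma mem_listing p : D p \in strong_components e.
Proof. by case: D_listing => _ <- _; apply: imset_f. Qed.

Lemma listing_cover x : exists p, x \in D p.
Proof.
have: x \in cover (strong_components e).
  by rewrite (cover_partition strong_components_partition) inE.
case: D_listing => _ <- _ /bigcupP[_ /imsetP[p _ ->] xDp].
by exists p.
Qed.

Lemma listing_pblock p x : x \in D p -> pblock (strong_components e) x = D p.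
Proof.
exact: def_pblock (partition_trivIset strong_components_partition) (mem_listing p).
Qed.

Lemma listing_inj p q x : x \in D p -> x \in D q -> p = q.
Proof.
move=> /listing_pblock Dp /listing_pblock Dq; case: D_listing => D_inj _ _.
by apply: D_inj; rewrite -Dp -Dq.
Qed.

Lemma listing_connect p x :
  x \in D p -> {in D p, forall y, connect e x y && connect e y x}.
Proof.
move=> xDp y; rewrite -(listing_pblock xDp).
by rewrite pblock_equivalence_partition ?inE //; apply: mutual_connect_equivalence.
Qed.

(* x lies in the class tagged v + m of D_(tag v). *)
Definition located v (m : nat) x : bool := x \in U (iter m (@ordS _) (tagged v)).

Lemma mem_U p (j : 'I_(kappa e (D p))) :
  U j \in [set U j | j : 'I_(kappa e (D p))].
Proof. exact: imset_f. Qed.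

Lemma U_subset p (j : 'I_(kappa e (D p))) : U j \subset D p.
Proof.
case: (U_imprimitive p) => _ /cover_partition covU _.
by rewrite -covU; apply: bigcup_sup (mem_U j).
Qed.

Lemma U_disjoint p (i j : 'I_(kappa e (D p))) x :
  x \in U i -> x \in U j -> i = j.
Proof.
case: (U_imprimitive p) => U_inj /partition_trivIset tU _ xi xj.
by apply: U_inj; rewrite -(def_pblock tU (mem_U i) xi) (def_pblock tU (mem_U j) xj).
Qed.

Lemma U_cover p x : x \in D p -> exists j : 'I_(kappa e (D p)), x \in U j.
Proof.
case: (U_imprimitive p) => _ /cover_partition covU _ xD.
have: x \in cover [set U j | j : 'I_(kappa e (D p))] by rewrite covU.
by move=> /bigcupP[_ /imsetP[j _ ->] xj]; exists j.
Qed.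

(** A component has a vertex, whose class has an index below [kappa]. *)
Lemma kappa_gt0 p : 0 < kappa e (D p).
Proof.
have /and3P[_ _ SC0] := strong_components_partition.
have /set0Pn[x] : D p != set0 by apply: contraNneq SC0 => <-; apply: mem_listing.
by move=> /U_cover[j _]; apply: leq_trans (ltn_ord j).
Qed.

Lemma located_mem v m x : located v m x -> x \in D (tag v).
Proof. exact: (subsetP (U_subset _)). Qed.

(** With the next two lemmas: at each time [m] the labels partition the vertices into nonempty
    blocks. *)
Lemma located_inj v w m x : located v m x -> located w m x -> v = w.
Proof.
case: v w => [p i] [q j] vx wx.
move: (listing_inj (located_mem vx) (located_mem wx)) => /= pq.
case: q / pq j wx => j wx; congr (Tagged _ _).
exact: iter_inj (@ordS_inj _) _ _ (U_disjoint vx wx).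
Qed.

Lemma located_ex m x : exists v, located v m x.
Proof.
have [p /U_cover[j xj]] := listing_cover x.
exists (Tagged (fun p => 'I_(kappa e (D p))) (iter m (@ord_pred _) j)).
suff jK: iter m (@ordS _) (iter m (@ord_pred _) j) = j by rewrite /located jK.
by elim: m => // m IHm; rewrite iterSr [iter m.+1 _ j]/= ord_predK.
Qed.

Lemma located_neq0 v m : exists x, located v m x.
Proof.
case: (U_imprimitive (tag v)) => _ /and3P[_ _ U0] _; apply/set0Pn.
by apply: contraNneq U0 => <-; apply: mem_U.
Qed.

Lemma located_step v m x y :
  located v m x -> e x y -> y \in D (tag v) -> located v m.+1 y.
Proof.
move=> vx exy yD; case: (U_imprimitive (tag v)) => _ _ /(_ x y) UP.
have [j [xj yj]] := UP (located_mem vx) yD exy.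
by rewrite /located /= (U_disjoint vx xj).
Qed.

Lemma cs_edge_arc v w m x y :
  located v m x -> located w m.+1 y -> e x y ->
  tag w = (tag v).+1 :> nat -> cs_edge U v w.
Proof.
move=> vx wy exy vw; split=> //.
exists (iter m (@ordS _) (tagged v)), (iter m.+1 (@ordS _) (tagged w)).
split; first by exists x, y.
(* The arc starts at time [m] and ends at time [m + 1]; this unit of time is the [+ 1] in
   [cs_edge]. *)
exists (- (m.+1)%:Z)%R; split; apply/esym/eqP.
  rewrite -addrA intS opprD addNKr.
  rewrite -(eqz_modDr m) subrK; apply/eqP/esym.
  exact/iter_ordS_eqz.
rewrite -(eqz_modDr m.+1) subrK; apply/eqP/esym.
exact/iter_ordS_eqz.
Qed.

(** * Crossing times and existence of walks *)

Definition period : nat := \prod_p kappa e (D p).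

Lemma period_gt0 : 0 < period.
Proof. by apply: prodn_gt0 => p; apply: kappa_gt0. Qed.

Lemma kappa_dvd_period p : kappa e (D p) %| period.
Proof. by rewrite /period (bigD1 p) //= dvdn_mulr. Qed.

(** The arc fits the labels whenever it is taken at a time congruent to [- a - 1] modulo [period], a
    common multiple of all [kappa]; any window of that length contains such a time. *)
Lemma arc_of_cs_edge (B : nat) v w : cs_edge U v w ->
  exists s x y,
    [/\ B <= s < B + period, e x y, located v s x & located w s.+1 y].
Proof.
case=> vw [k [l [[x [y [xk yl exy]]] [a [ka la]]]]].
pose r := ((- a - 1 - B%:Z)%R %% period)%Z.
have r_ge0 : (0 <= r)%R by rewrite modz_ge0 // eqz_nat -lt0n period_gt0.
have r_lt : (r < period)%R by rewrite ltz_pmod // ltz_nat period_gt0.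
have def_r : `|r|%N%:Z%R = r by rewrite gez0_abs.
have dvd_s p : (kappa e (D p) %| (B%:Z + r + 1 + a)%R)%Z.
  apply: (@dvdz_trans period); first exact: kappa_dvd_period.
  have := divz_eq (- a - 1 - B%:Z)%R period; rewrite -/r.
  move: (_ %/ _)%Z => q def_a; apply/dvdzP; exists (- q)%R.
  have -> : a = (- (q * period + r) - 1 - B%:Z)%R by rewrite -def_a; ring.
  ring.
exists (B + `|r|), x, y; split=> //.
- by rewrite leq_addr ltn_add2l -ltz_nat def_r.
- rewrite /located; have -> // : iter (B + `|r|) (@ordS _) (tagged v) = k.
  apply/iter_ordS_eqz/eqP; rewrite eqz_mod_dvd PoszD def_r.
  move/eqP: ka; rewrite eqz_mod_dvd => /(rpredD (dvd_s (tag v))).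
  by congr (_ %| _)%Z; ring.
- rewrite /located; have -> // : iter (B + `|r|).+1 (@ordS _) (tagged w) = l.
  apply/iter_ordS_eqz/eqP; rewrite eqz_mod_dvd -addn1 !PoszD def_r.
  move/eqP: la; rewrite eqz_mod_dvd => /(rpredD (dvd_s (tag w))).
  by congr (_ %| _)%Z; ring.
Qed.

Lemma path_of_walk v s m x y : located v s x -> walk m x y ->
  exists2 w, partite_path v w & located w (s + m) y.
Proof.
move=> vx; elim: m y => [|m IHm] y.
  rewrite digraph_power0 addn0 => /eqP <-.
  by exists v => //; apply: partite_path_refl.
move=> /digraph_power_rconsP[z /IHm[w vw wz] ezy]; rewrite addnS.
have [w' w'y] := located_ex (s + m).+1 y.
have [tw|ntw] := eqVneq (tag w) (tag w').
  exists w => //; apply: located_step ezy _ => //.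
  by rewrite tw; apply: located_mem w'y.
have [_ _ D_arc] := D_listing.
have tw' := D_arc _ _ _ _ ntw (located_mem wz) (located_mem w'y) ezy.
exists w' => //; apply: (partite_path_rcons vw _ tw').
by left; apply: cs_edge_arc wz w'y ezy tw'.
Qed.

(** A short walk from [x] to [y] has the right length modulo [kappa]; a closed walk at [x] fills up
    the remaining length. *)
Lemma eventual_walks_in_component : exists N, forall v (s m : nat) x y,
  located v s x -> located v (s + m) y -> N <= m -> walk m x y.
Proof.
have closed x : exists N, forall v s, located v s x -> forall n,
    N <= n -> kappa e (D (tag v)) %| n -> walk n x x.
  have [p xp] := listing_cover x.
  have [N HN] := eventual_closed_walks (listing_connect xp).
  by exists N => v s /located_mem xv; rewrite (listing_inj xv xp).
have [N HN] := fin_all_exists closed.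
exists (\max_x N x + #|T|) => v s m x y vx vy le_m.
have /andP[/connect_digraph_power[n le_n xy] _] :=
  listing_connect (located_mem vx) (located_mem vy).
have le_nm : n <= m by apply: leq_trans le_n (leq_trans (leq_addl _ _) le_m).
rewrite -(subnK le_nm); apply: (digraph_powerD _ xy).
apply: (HN x v s vx).
  rewrite (leq_trans (leq_bigmax x)) // leq_subRL // addnC.
  by apply: leq_trans le_m; rewrite leq_add2l.
have [w vw wy] := path_of_walk vx xy.
have tw : tag w = tag v by apply: listing_inj (located_mem wy) (located_mem vy).
(* The traced path starts and ends in one part, so the label has not changed. *)
have def_w : w = v by apply: (partite_path_part_eq vw); rewrite /= tw.
rewrite def_w in wy; have /(congr1 val) := U_disjoint vy wy.
rewrite /= !val_iter_ordS !addnA => /eqP.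
by rewrite eqn_mod_dvd ?leq_add2l // subnDl.
Qed.

Lemma eventual_walks_of_path : exists M, forall v w m x y,
  partite_path v w -> located v 0 x -> located w m y -> M <= m -> walk m x y.
Proof.
have [N HN] := eventual_walks_in_component.
(* Each further part costs at most [period] to wait for and make the crossing, then [N] to reach any
   target in the new component. *)
pose bound (t : nat) := N + t * (period + N).
suff walks v w : partite_path v w -> forall m x y,
    located v 0 x -> located w m y -> bound (part w) <= m -> walk m x y.
  exists (bound eta) => v w m x y vw vx wy le_m.
  apply: (walks v w) => //; apply: leq_trans le_m.
  by rewrite leq_add2l leq_mul2r ltnW ?orbT.
move: w; apply: partite_path_ind => [|w w' IHw ww' tw'] m x y vx wy le_m.
  by apply: (HN v 0) => //; apply: leq_trans (leq_addr _ _) le_m.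
(* [cs_adj] is symmetric; the reversed edge would go down one part. *)
case: ww' => [ww'|[tw _]]; last first.
  by move: tw' (leqnn (tag w)) => /= tw'; rewrite {1}tw tw' ltnNge leqnSn.
have [s [z [z' [/andP[le_s lt_s] ezz' wz w'z']]]] :=
  arc_of_cs_edge (bound (tag w)) ww'.
have le_sm : s.+1 + N <= m.
  apply: leq_trans le_m; rewrite tw'.
  have -> : bound (tag w).+1 = bound (tag w) + period + N by rewrite /bound; ring.
  by rewrite leq_add2r.
have le_s1 : s.+1 <= m by apply: leq_trans (leq_addr _ _) le_sm.
rewrite -(subnKC le_s1) -addn1; apply: digraph_powerD.
  by apply: digraph_powerD (IHw _ _ _ vx wz le_s) (digraph_power1 ezz').
rewrite addn1; apply: (HN w' s.+1) => //; first by rewrite subnKC.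
by rewrite leq_subRL.
Qed.

(** A common out-neighbour in the power has a single label at time [m]; conversely any vertex of the
    nonempty block of [u] at time [m] serves as one. The right-hand side is free of [m], whence
    convergence. *)
Lemma competition_of_paths : exists M, forall v w m x y,
  M <= m -> located v 0 x -> located w 0 y ->
  competition_graph (walk m) x y <->
  x != y /\ exists u, partite_path v u /\ partite_path w u.
Proof.
have [M HM] := eventual_walks_of_path.
exists M => v w m x y le_m vx wy /=; split.
  move=> /andP[-> /existsP[z /andP[xz yz]]]; split=> //.
  have [u vu uz] := path_of_walk vx xz; have [u' wu' u'z] := path_of_walk wy yz.
  by exists u; rewrite {2}(located_inj uz u'z).
move=> [nxy [u [vu wu]]]; apply/andP; split=> //; apply/existsP.
have [z uz] := located_neq0 u m.
by exists z; rewrite (HM v u) ?(HM w u).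
Qed.

Lemma limit_is_expansion : exists L : rel T,
  graph_limit (fun m => competition_graph (walk m)) L /\ is_expansion G L.
Proof.
have [M HM] := competition_of_paths.
exists (competition_graph (walk M)); split.
  exists M => m le_m x y; have [v vx] := located_ex 0 x.
  have [w wy] := located_ex 0 y.
  by apply/idP/idP => /(HM v w _ x y _ vx wy)/(HM v w _ x y _ vx wy); apply.
(* The complete graph replacing [v] lives on the vertices labelled [v] at time 0. *)
exists (fun v => [set x | located v 0 x]); split.
- by move=> v; have [x vx] := located_neq0 v 0; apply/set0Pn; exists x; rewrite inE.
- move=> v w nvw; rewrite disjoints_subset; apply/subsetP => x; rewrite !inE => vx.
  by apply: contra nvw => wx; rewrite (located_inj vx wx).
- apply/setP=> x; rewrite inE; apply/bigcupP; have [v vx] := located_ex 0 x.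
  by exists v; rewrite ?inE.
move=> x y; split=> [xy|[v [w []]]].
  have [v vx] := located_ex 0 x; have [w wy] := located_ex 0 y.
  have [nxy vw] := (HM v w M x y (leqnn M) vx wy).1 xy.
  exists v, w; rewrite !inE; split=> //.
  have [->|nvw] := eqVneq v w; first by left.
  by right; split=> //; apply/step2_joinedP.
rewrite !inE => vx wy vw; apply/(HM v w M x y (leqnn M) vx wy).
case: vw => [[vw nxy]|[nvw /step2_joinedP vw]].
  (* Distinct vertices with equal labels compete through the trivial path, so blocks are
     complete. *)
  by split=> //; exists v; rewrite -vw; split; apply: partite_path_refl.
split=> //; apply: contra nvw => /eqP xy.
by rewrite xy in vx; rewrite (located_inj vx wy).
Qed.

End LinearlyConnected.

Theorem theorem3p14 (T : finType) (e : rel T) (eta : nat)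
    (D : 'I_eta -> {set T})
    (U : forall p : 'I_eta, 'I_(kappa e (D p)) -> {set T})
    (e_simple : irreflexive e)
    (D_linear : linearly_connected e D)
    (D_nontrivial : forall p : 'I_eta, 1 < #|D p|)
    (eta_ge3 : 3 <= eta)
    (U_imprimitive : forall p : 'I_eta, imprimitivity_sets (U p)) :
  exists L : rel T,
    graph_limit (fun m => competition_graph (digraph_power e m)) L /\
    is_expansion (cs_graph U) L.
Proof. by case: D_linear => _ D_listing; apply: limit_is_expansion. Qed.
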